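(* Let $\mathcal{A}$ be an algebra with two multiplications $\cdot$ and $\ast$ (see context), and let $\kappa$ be the associated cumulants. Let $A_1,\dots,A_n$ be finite multisets of elements of $\mathcal{A}$, $A_i=\{a^i_1,\dots,a^i_{k_i}\}$, and let $A=A_1\cup\cdots\cup A_n$ be their multiset union. Then $$\left(a^1_1\ast\cdots\ast a^1_{k_1}\right)\cdot\,\cdots\,\cdot\left(a^n_1\ast\cdots\ast a^n_{k_n}\right)=\sum_{F\in\overline{\mathcal{F}}(A)}(-1)^{w_F}\,\kappa_F ,$$ where $\overline{\mathcal{F}}(A)$ is the set of reduced mixing forests with leaves in $A$.
   Context: An algebra with two multiplications is a vector space $\mathcal{A}$ over a field with two bilinear products $\cdot$ and $\ast$ such that $(\mathcal{A},\cdot)$ and $(\mathcal{A},\ast)$ are both commutative associative unital algebras. The cumulants are the multilinear maps $\kappa:\mathcal{A}^m\to\mathcal{A}$ ($m\ge1$), symmetric in their arguments, uniquely determined (recursively in $m$) by the moment–cumulant formula $a_1\ast\cdots\ast a_m=\sum_{\nu}\prod_{b\in\nu}\kappa(a_i:i\in b)$ for all $a_1,\dots,a_m\in\mathcal{A}$, where $\nu$ runs over all set partitions of $\{1,\dots,m\}$ and the product over blocks is the $\cdot$-product; in particular $\kappa(a)=a$. The elements $a^i_j$ of the multiset $A$ are regarded as distinguishable (indexed by $(i,j)$) even if equal in $\mathcal{A}$; $a^i_j$ is said to belong to $A_i$. A reduced forest with leaves in $A$ is a finite forest of rooted trees with unordered children whose leaves (vertices with no children; a one-vertex tree consists of a single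 leaf which is also its root) are labelled bijectively by the elements of $A$, and in which every non-leaf vertex has at least two children; forests are taken up to isomorphism of rooted forests preserving leaf labels. For such $F$ define $\kappa_v$ for vertices $v$ inductively: $\kappa_v=a_v$ (the label) if $v$ is a leaf, and $\kappa_v=\kappa(\kappa_{v_1},\dots,\kappa_{v_m})$ if $v$ has children $v_1,\dots,v_m$; then $\kappa_F$ is the $\ast$-product of $\kappa_V$ over all roots $V$ of $F$. $F$ is mixing if for every vertex $v$ all of whose children are leaves, those children are labelled by elements belonging to at least two distinct multisets $A_i\neq A_j$. For a mixing reduced forest, $w_F$ is the number of vertices of $F$ minus the number of leaves. *)

(* Defs.v *)
From HB Require Import structures.
From mathcomp Require Import all_boot all_order all_algebra.

Set Implicit Arguments.
Unset Strict Implicit.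
Unset Printing Implicit Defensive.

Import GRing.Theory.
Local Open Scope ring_scope.

(* An algebra with two multiplications is a vector space V with two terms     *)
(* dot, star : comAlgProduct V. The units of dot and star may differ, in      *)
(* which case the expansion into mixing forests fails for empty families:     *)
(* with families {x} and {}, it would read dot x (punit star) = x.            *)
Record comAlgProduct (K : fieldType) (V : lmodType K) := ComAlgProduct {
  pmul :> V -> V -> V;
  punit : V;
  pmul_assoc : associative pmul;
  pmul_comm : commutative pmul;
  pmul_onel : left_id punit pmul;
  pmul_linear : forall (c : K) (x y z : V),
    pmul (c *: x + y) z = c *: pmul x z + pmul y z
}.

HB.instance Definition _ (K : fieldType) (V : lmodType K)
    (m : comAlgProduct V) :=
  Monoid.isComLaw.Build V (punit m) (pmul m)
    (@pmul_assoc K V m) (@pmul_comm K V m) (@pmul_onel K V m).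

Section Cumulants.

Variables (K : fieldType) (V : lmodType K) (dot star : comAlgProduct V).

Implicit Types (kappa : seq V -> V) (s t : seq V).

(* A family of maps V^m -> V, m >= 1, is represented by a map on sequences;   *)
(* its value on the empty sequence is irrelevant.                             *)
Definition moment_cumulant kappa : Prop :=
  forall s, s != [::] ->
    \big[star/punit star]_(x <- s) x =
    \sum_(P : {set {set 'I_(size s)}} | partition P setT)
       \big[dot/punit dot]_(B in P) kappa [seq s`_i | i : 'I_(size s) in B].

(* The moment-cumulant formula solved for the term of the one-block           *)
(* partition; n bounds the depth of the recursion.                            *)
Fixpoint cumulant_rec (n : nat) s : V :=
  if n is n'.+1 then
    \big[star/punit star]_(x <- s) x -
    \sum_(P : {set {set 'I_(size s)}} | partition P setT && (P != [set setT]))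
       \big[dot/punit dot]_(B in P)
          cumulant_rec n' [seq s`_i | i : 'I_(size s) in B]
  else 0.

Definition cumulant s : V := cumulant_rec (size s) s.

Lemma size_block s (P : {set {set 'I_(size s)}}) B :
  partition P setT -> P != [set setT] -> B \in P ->
  (0 < size [seq (s`_i)%R | i : 'I_(size s) in B] < size s)%N.
Proof.
move=> Ppart PT PB; rewrite size_map -cardE card_gt0.
have [_ triv P0] := and3P Ppart.
have -> /= : B != set0 by apply: contraNneq P0 => <-.
rewrite -[X in (_ < X)%N]card_ord -cardsT proper_card // properT.
apply: contraNneq PT => BT; rewrite BT in PB; apply/eqP/setP=> C.
rewrite inE; apply/idP/eqP => [PC|->//]; apply/eqP; apply: contraNT P0 => CT.
suff /eqP <- : C == set0 by [].
by move/trivIsetP: triv => /(_ _ _ PC PB CT); rewrite -setI_eq0 setIT.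
Qed.

Lemma cumulant_recE n s :
  (0 < size s <= n)%N -> cumulant_rec n s = cumulant s.
Proof.
rewrite /cumulant; move: {2 5}(size s) (leqnn (size s)) => m.
elim: m n s => [|m IH] [|n] s le_sm /andP[s_gt0 le_sn].
- by rewrite leqNgt s_gt0 in le_sm.
- by rewrite leqNgt s_gt0 in le_sm.
- by rewrite leqNgt s_gt0 in le_sn.
congr (_ - _); apply: eq_bigr => P /andP[Ppart PT].
apply: eq_bigr => B PB; have /andP[B0 Bs] := size_block Ppart PT PB.
by apply: IH; rewrite ?B0 -ltnS (leq_trans Bs).
Qed.

Lemma cumulantE s : s != [::] ->
  cumulant s = \big[star/punit star]_(x <- s) x -
    \sum_(P : {set {set 'I_(size s)}} | partition P setT && (P != [set setT]))
       \big[dot/punit dot]_(B in P) cumulant [seq s`_i | i : 'I_(size s) in B].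
Proof.
move=> s_neq0; rewrite {1}/cumulant.
case Ds: {1}(size s) => [|n] /=; first by rewrite (size0nil Ds) in s_neq0.
congr (_ - _); apply: eq_bigr => P /andP[Ppart PT].
apply: eq_bigr => B PB; have /andP[B0 Bs] := size_block Ppart PT PB.
by rewrite cumulant_recE // B0 -ltnS -Ds.
Qed.

Lemma partition_setT1 s : s != [::] ->
  partition [set [set: 'I_(size s)]] setT.
Proof.
case: s => // x s _; rewrite /partition /cover big_set1 eqxx inE /=.
rewrite eq_sym -card_gt0 cardsT card_ord andbT.
by apply/trivIsetP=> A B /set1P-> /set1P->; rewrite eqxx.
Qed.

Lemma moment_cumulantE kappa s : s != [::] ->
  \sum_(P : {set {set 'I_(size s)}} | partition P setT)
     \big[dot/punit dot]_(B in P) kappa [seq s`_i | i : 'I_(size s) in B] =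
  kappa s +
  \sum_(P : {set {set 'I_(size s)}} | partition P setT && (P != [set setT]))
     \big[dot/punit dot]_(B in P) kappa [seq s`_i | i : 'I_(size s) in B].
Proof.
move=> s_neq0; rewrite (bigD1 [set setT]) ?partition_setT1 //= big_set1.
congr (kappa _ + _); rewrite -[RHS](mkseq_nth 0) /mkseq -val_enum_ord -map_comp.
by rewrite /image_mem enum_setT -enumT.
Qed.

Lemma cumulantP : moment_cumulant cumulant.
Proof. by move=> s s0; rewrite moment_cumulantE // cumulantE // subrK. Qed.

Lemma cumulant_uniq kappa :
  moment_cumulant kappa -> forall s, s != [::] -> kappa s = cumulant s.
Proof.
move=> kappaP s; move: {2}(size s) (leqnn (size s)) => m.
elim: m s => [|m IH] s le_sm s0; first by case: s le_sm s0.
rewrite cumulantE // kappaP // moment_cumulantE // -addrA -[LHS]addr0.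
congr (_ + _); apply/esym/eqP; rewrite subr_eq0; apply/eqP.
apply: eq_bigr => P /andP[Ppart PT]; apply: eq_bigr => B PB.
have /andP[B0 Bs] := size_block Ppart PT PB.
by apply: IH; rewrite -?size_eq0 -?lt0n // -ltnS (leq_trans Bs).
Qed.

Lemma cumulant_perm s t : perm_eq s t -> cumulant s = cumulant t.
Proof.
move: {2}(size s) (leqnn (size s)) => m.
elim: m s t => [|m IH] s t le_sm st.
  move: st; move: le_sm; rewrite leqn0 => /eqP/size0nil ->.
  by rewrite perm_sym => /perm_nilP ->.
have [s0|s0] := eqVneq s [::].
  by move: st; rewrite s0 perm_sym => /perm_nilP ->.
have t0 : t != [::].
  by apply: contraNneq s0 => t0; move: st; rewrite t0 => /perm_nilP ->.
rewrite !cumulantE // (perm_big _ st) /=; congr (_ - _).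
have Est := perm_size st.
have [f fK nth_f] : exists2 f : 'I_(size s) -> 'I_(size t), injective f &
    forall i : 'I_(size s), s`_i = t`_(f i).
  have /(perm_iotaP 0) [js js_perm Ds] := st.
  have sz_js : size js = size t by rewrite (perm_size js_perm) size_iota.
  have js_lt (i : 'I_(size s)) : (nth 0 js i < size t)%N.
    have: nth 0%N js i \in js by rewrite mem_nth // sz_js -Est.
    by rewrite (perm_mem js_perm) mem_iota.
  exists (fun i => Ordinal (js_lt i)) => [i j [] /eqP|i] /=.
    rewrite nth_uniq ?sz_js -?Est // ?(perm_uniq js_perm) ?iota_uniq //.
    by move/eqP/val_inj.
  by rewrite {1}Ds (nth_map 0%N) // sz_js -Est.
have f_bij : bijective f by apply: inj_card_bij; rewrite ?card_ord // Est.
have [g gK fKg] := f_bij.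
have imK (I J : finType) (u : I -> J) (v : J -> I) : cancel u v ->
    cancel (fun B : {set I} => u @: B) (fun B : {set J} => v @: B).
  by move=> uK B; rewrite -imset_comp (eq_imset _ uK) imset_id.
pose h (P : {set {set 'I_(size s)}}) := [set f @: (B : {set _}) | B in P].
have h_bij : bijective h.
  exists (fun P : {set {set 'I_(size t)}} => [set g @: (B : {set _}) | B in P]).
    exact/(imK _ _ _ _ (imK _ _ _ _ gK)).
  exact/(imK _ _ _ _ (imK _ _ _ _ fKg)).
have fT : f @: [set: 'I_(size s)] = setT.
  by apply/setP=> j; rewrite inE -[j]fKg imset_f.
rewrite [RHS](reindex h) /=; last exact: onW_bij h_bij.
apply: eq_big => [P|P /andP[Ppart PT]].
  rewrite -{1}fT imset_partition //; congr (_ && ~~ _).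
  have -> : [set setT] = h [set setT] by rewrite /h imset_set1 fT.
  by rewrite (inj_eq (bij_inj h_bij)).
rewrite /h big_imset /=; last by move=> B C _ _; apply: imset_inj.
apply: eq_bigr => B PB; have /andP[B0 Bs] := size_block Ppart PT PB.
apply: IH; first by rewrite -ltnS (leq_trans Bs).
rewrite /image_mem (eq_map nth_f) (map_comp (nth 0 t \o val) f) /=.
rewrite [X in perm_eq _ X](_ : _ = map (nth 0 t \o val) (enum (f @: B))) //.
apply/perm_map/uniq_perm; rewrite ?enum_uniq ?(map_inj_uniq fK) ?enum_uniq //.
move=> j; rewrite mem_enum; apply/mapP/imsetP => [] [i Bi ->]; exists i => //.
  by rewrite -(mem_enum B).
by rewrite mem_enum.
Qed.

Lemma cumulant_linear (c : K) (x y : V) s :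
  cumulant (c *: x + y :: s) = c *: cumulant (x :: s) + cumulant (y :: s).
Proof.
have [m] := ubnP (size s); elim: m s => // m IH s le_sm.
rewrite !cumulantE // !big_cons pmul_linear scalerBr addrACA -opprD.
congr (_ - _); rewrite scaler_sumr -big_split /=.
apply: eq_bigr => P /andP[Ppart PT].
have [/eqP covP triv _] := and3P Ppart.
have cov0 : ord0 \in cover P by rewrite covP inE.
have PB := pblock_mem cov0.
have B0 : ord0 \in pblock P ord0 by rewrite mem_pblock.
have B_size := @size_block (0 :: s) P _ Ppart PT PB.
pose r := [seq (0 :: s)`_i | i : 'I_(size s).+1 in pblock P ord0 :\ ord0].
have rE z : perm_eq
    [seq (z :: s)`_i | i : 'I_(size s).+1 in pblock P ord0] (z :: r).
  rewrite /image_mem (_ : z :: r = [seq (z :: s)`_(i : 'I_(size s).+1)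
    | i <- ord0 :: enum (pblock P ord0 :\ ord0)]); last first.
    by congr (_ :: _); apply/eq_in_map => -[[|i] lt_i] //;
       rewrite mem_enum !inE.
  apply/perm_map/uniq_perm; rewrite /= ?mem_enum ?inE ?eqxx ?enum_uniq //.
  move=> i; rewrite in_cons !mem_enum !inE.
  by have [->|] := eqVneq i ord0.
have lt_r : (size r < size s)%N.
  by move: B_size; rewrite (perm_size (rE 0)).
rewrite !(bigD1 _ PB) /= (cumulant_perm (rE _)) (cumulant_perm (rE x)).
rewrite (cumulant_perm (rE y)) IH; last exact: leq_trans lt_r _.
rewrite pmul_linear.
suff rest z : \big[dot/punit dot]_(B in P | B != pblock P ord0)
     cumulant [seq (z :: s)`_i | i : 'I_(size s).+1 in B] =
   \big[dot/punit dot]_(B in P | B != pblock P ord0)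
     cumulant [seq (0 :: s)`_i | i : 'I_(size s).+1 in B].
  by rewrite !rest.
apply: eq_bigr => B /andP[PB' neqB]; congr cumulant.
apply/eq_in_map => -[[|i] lt_i] //; rewrite mem_enum => B0'.
case/eqP: neqB; rewrite -(def_pblock triv PB' B0').
by congr (pblock _ _); apply: val_inj.
Qed.

End Cumulants.

Section Forests.

Variable L : finType.

(* [tree h]: isomorphism classes of rooted trees of height at most h with     *)
(* unordered children, labelled by L at the leaves; [inr C] is a non-leaf     *)
(* vertex with set of children C. Using sets rather than multisets loses      *)
(* nothing here, because equal siblings would repeat a leaf label.            *)
Fixpoint tree (h : nat) : finType :=
  if h is h'.+1 then (L + {set tree h'})%type else L.

Definition leaf (h : nat) : L -> tree h :=
  if h is h'.+1 return L -> tree h then inl else id.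

Fixpoint tree_leaves (h : nat) : tree h -> seq L :=
  match h return tree h -> seq L with
  | 0 => fun x => [:: x]
  | h'.+1 => fun t =>
    match t with
    | inl x => [:: x]
    | inr C => flatten [seq @tree_leaves h' u | u in C]
    end
  end.

Fixpoint tree_order (h : nat) : tree h -> nat :=
  match h return tree h -> nat with
  | 0 => fun=> 1%N
  | h'.+1 => fun t =>
    match t with
    | inl _ => 1%N
    | inr C => (\sum_(u in C) @tree_order h' u).+1
    end
  end.

Fixpoint tree_height (h : nat) : tree h -> nat :=
  match h return tree h -> nat with
  | 0 => fun=> 0%N
  | h'.+1 => fun t =>
    match t with
    | inl _ => 0%N
    | inr C => (\max_(u in C) @tree_height h' u).+1
    end
  end.

Fixpoint tree_reduced (h : nat) : pred (tree h) :=
  match h return pred (tree h) with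
  | 0 => fun=> true
  | h'.+1 => fun t =>
    match t with
    | inl _ => true
    | inr C => (1 < #|C|)%N && [forall u in C, @tree_reduced h' u]
    end
  end.

(* c x is the index i such that the leaf label x belongs to A_i. A leaf,      *)
(* which has no children, carries no condition.                               *)
Fixpoint tree_mixing (I : eqType) (c : L -> I) (h : nat) : pred (tree h) :=
  match h return pred (tree h) with
  | 0 => fun=> true
  | h'.+1 => fun t =>
    match t with
    | inl _ => true
    | inr C =>
      ([forall u in C, [exists x, u == leaf h' x]] ==>
         [exists x, exists y,
            [&& leaf h' x \in C, leaf h' y \in C & c x != c y]])
      && [forall u in C, tree_mixing c u]
    end
  end.

Lemma reduced_height (h : nat) (t : tree h) :
  tree_reduced t -> (tree_height t < size (tree_leaves t))%N.
Proof.
elim: h t => [|h IH] //= [x|C] //= /andP[C_gt1 /forall_inP redC].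
rewrite size_flatten /shape -map_comp sumnE big_map big_enum /=.
have [u uC ->] := eq_bigmax_cond (@tree_height h) (ltnW C_gt1).
rewrite (bigD1 u) //=.
have [v vC] : exists v, v \in C :\ u.
  by apply/card_gt0P; move: C_gt1; rewrite (cardsD1 u C) uC.
move: vC; rewrite !inE => /andP[vu vC].
rewrite (bigD1 v) /= ?vC ?vu // -addn1 addnA.
apply: leq_trans (leq_addr _ _).
have := leq_add (IH u (redC u uC)) (IH v (redC v vC)).
by apply: leq_trans; rewrite addSn ltnS leq_add2l.
Qed.

(* By [reduced_height] the bound on the height excludes no reduced forest     *)
(* whose leaves are labelled bijectively by L.                                *)
Definition forest : finType := {set tree #|L|}.

Definition forest_leaves (F : forest) : seq L :=
  flatten [seq tree_leaves t | t in F].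

Definition forest_order (F : forest) : nat := (\sum_(t in F) tree_order t)%N.

Definition reduced_forest (F : forest) : bool :=
  perm_eq (forest_leaves F) (enum L) && [forall t in F, tree_reduced t].

Definition mixing_forest (I : eqType) (c : L -> I) (F : forest) : bool :=
  [forall t in F, tree_mixing c t].

Definition forest_weight (F : forest) : nat :=
  (forest_order F - size (forest_leaves F))%N.

Variables (K : fieldType) (V : lmodType K) (dot star : comAlgProduct V).
Variable a : L -> V.

Fixpoint tree_cumulant (h : nat) : tree h -> V :=
  match h return tree h -> V with
  | 0 => fun x => a x
  | h'.+1 => fun t =>
    match t with
    | inl x => a x
    | inr C => cumulant dot star [seq @tree_cumulant h' u | u in C]
    end
  end.

Definition forest_cumulant (F : forest) : V :=
  \big[star/punit star]_(t in F) tree_cumulant t.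

End Forests.

(* Main.v *)
Require Import Defs.
From mathcomp Require Import all_boot all_order all_algebra.

(* For a set b of leaves let tau(b) be the signed sum of kappa_t over the     *)
(* reduced mixing trees t with leaf set b. If b has at least two elements,    *)
(* expanding at the root by multilinearity gives                              *)
(*    tau(b) = - sum_pi kappa(tau(B) : B in pi)                               *)
(* over the partitions pi of b with several blocks, except the partition into *)
(* singletons when b lies in one A_i. As kappa(tau(b)) = tau(b), this reads   *)
(*    sum_(pi partition of b) kappa(tau(B) : B in pi) =                       *)
(*       kappa(a_x : x in b) if b lies in one A_i, and 0 otherwise.           *)
(* The sum over forests is the sum over partitions pi of the star products    *)
(* of the tau(B), B in pi. Expand each of these by the moment-cumulant        *)
(* formula, which partitions pi, and regroup by the coarser partition sigma:  *)
(* by the displayed identity only the sigma refining {A_1, ..., A_n} remain,  *)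
(* with the dot product of the kappa(a_x : x in b), b in sigma. The           *)
(* moment-cumulant formula in each A_i turns this into the left-hand side.    *)

Set Implicit Arguments.
Unset Strict Implicit.
Unset Printing Implicit Defensive.

Import GRing.Theory.
Local Open Scope ring_scope.

(** The tree recursion and the regrouping of partitions in the outline come from one principle: a
    symmetric multilinear map applied to sums, one for each block of a partition, is a sum over
    choices of one summand per block ([multilinear_expand]). With trees keyed by their leaf sets it
    gives the recursion [tree_sum_node] for tau and the sum over forests; with partitions keyed by
    their unions it gives [double_partition], which trades a coarse partition for a fine one. The
    cancellation is [sum_kappa_tree_sum]: the signs kill every block of the coarse partition that
    meets two of the A_i. What survives is the expansion, in [refined_moments], of the [dot] product
    of [star] products; [forest_sum] matches the two. *)

Lemma mem_image_imset (T J : finType) (key : T -> J) (C : {set T}) (B : J) :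
  (B \in [seq key u | u in C]) = (B \in key @: C).
Proof. by apply/imageP/imsetP=> -[u Cu ->]; exists u. Qed.

Lemma perm_enum_setU1 (T : finType) (u : T) (C : {set T}) :
  u \notin C -> perm_eq (enum (u |: C)) (u :: enum C).
Proof.
move=> Cu; apply: uniq_perm; rewrite /= ?enum_uniq ?mem_enum ?Cu //.
by move=> v; rewrite in_cons !mem_enum !inE.
Qed.

(** * Multilinear expansion over choices of summands *)

Section Multilinear.

Variables (K : fieldType) (V : lmodType K).

Definition symmetric_multilinear (M : seq V -> V) : Prop :=
  (forall s t, perm_eq s t -> M s = M t) /\
  (forall c x y s, M (c *: x + y :: s) = c *: M (x :: s) + M (y :: s)).

Lemma symmetric_multilinear_big (m : comAlgProduct V) :
  symmetric_multilinear (fun s => \big[m/punit m]_(x <- s) x).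
Proof.
split=> [s t /(perm_big _) -> // | c x y s].
by rewrite !big_cons pmul_linear.
Qed.

Lemma symmetric_multilinear_cumulant (dot star : comAlgProduct V) :
  symmetric_multilinear (cumulant dot star).
Proof. by split; [exact: cumulant_perm | exact: cumulant_linear]. Qed.

Variable M : seq V -> V.
Hypothesis M_ml : symmetric_multilinear M.

Lemma multilinear_sum (J : Type) (r : seq J) (P : pred J) (w : J -> K)
    (g : J -> V) s :
  M (\sum_(u <- r | P u) w u *: g u :: s) =
  \sum_(u <- r | P u) w u *: M (g u :: s).
Proof.
have [_ M_lin] := M_ml; elim/big_rec2: _ => [|u _ y _ <-]; last exact: M_lin.
apply: (@addIr _ (M (0 :: s))); rewrite add0r.
by rewrite -[X in X + _]scale1r -M_lin scaler0 addr0.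
Qed.

Variables (T J : finType) (key : T -> J) (good : pred T).
Variables (w : T -> K) (g : T -> V).

(** Induction on [r]; the tail [s] collects the arguments already expanded, which symmetry moves
    behind the others. *)
Lemma multilinear_expand_seq (r : seq J) s : uniq r ->
  M ([seq \sum_(u | good u && (key u == B)) w u *: g u | B <- r] ++ s) =
  \sum_(C : {set T} | [forall u in C, good u]
                      && perm_eq [seq key u | u in C] r)
     (\prod_(u in C) w u) *: M ([seq g u | u in C] ++ s).
Proof.
have [M_perm _] := M_ml; elim: r s => [|B r IH] s /=.
  move=> _; rewrite (big_pred1 set0) => [|C].
    by rewrite big_set0 scale1r /image_mem enum_set0.
  apply/andP/eqP => [[_]|->].
    move/perm_nilP/(congr1 size); rewrite size_map -cardE /=.
    by move/eqP; rewrite cards_eq0 => /eqP.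
  by split; [apply/forall_inP=> u; rewrite inE | rewrite /image_mem enum_set0].
case/andP=> Br r_uniq; rewrite multilinear_sum.
pose Q r (C : {set T}) := [forall u in C, good u]
                      && perm_eq [seq key u | u in C] r.
have QU1 (u : T) (C : {set T}) : key u = B -> u \notin C ->
    Q (B :: r) (u |: C) = good u && Q r C.
  move=> <- Cu; rewrite /Q (permPl (perm_map key (perm_enum_setU1 Cu))) /=.
  rewrite perm_cons andbA; congr (_ && _); apply/forall_inP/andP=> [goodC|].
    split; first by apply: goodC; rewrite setU11.
    by apply/forall_inP=> v Cv; apply: goodC; rewrite setU1r.
  by case=> gu /forall_inP goodC v /setU1P[->|/goodC].
(* The inner sum has exactly one term, the element of [C] over [B]; exchanging the sums then peels
   off the choice made for [B]. *)
transitivity (\sum_(C : {set T} | Q (B :: r) C)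
    \sum_(u | (u \in C) && (key u == B))
     (\prod_(u in C) w u) *: M ([seq g u | u in C] ++ s)); last first.
  apply: eq_bigr => C /andP[_ CB].
  have /mapP[u] : B \in [seq key u | u in C] by rewrite (perm_mem CB) mem_head.
  rewrite mem_enum => Cu Bu; rewrite (big_pred1 u) // => v.
  have /dinjectiveP key_inj : dinjectiveb key (mem C).
    by rewrite /dinjectiveb (perm_uniq CB) /= Br.
  apply/andP/eqP => [[Cv /eqP Bv]|->]; last by rewrite Cu Bu.
  by apply: key_inj; rewrite // Bv.
rewrite (exchange_big_dep (fun u => good u && (key u == B))) /=; last first.
  by move=> C u /andP[/forall_inP goodC _] /andP[Cu ->]; rewrite goodC.
apply: eq_bigr => u /andP[good_u /eqP key_u].
rewrite (M_perm _ ([seq \sum_(u | good u && (key u == B)) w u *: g u | B <- r]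
    ++ g u :: s)); last by rewrite -cat1s perm_catCA.
rewrite {}IH // scaler_sumr key_u eqxx.
rewrite [RHS](reindex_onto (fun C => u |: C) (fun C => C :\ u)) /=; last first.
  by move=> C /andP[_ /andP[Cu _]]; rewrite setD1K.
apply: eq_big => C; last first.
  case/andP=> _ Cr; have Cu : u \notin C.
    apply: contra Br => Cu; rewrite -(perm_mem Cr) -key_u.
    by rewrite map_f // mem_enum.
  rewrite big_setU1 //= scalerA; congr (_ *: _); apply: M_perm.
  rewrite -cat1s perm_catCA /= -cat_cons perm_cat2r perm_sym.
  exact: (perm_map g (perm_enum_setU1 Cu)).
have [Cu|Cu] := boolP (u \in C).
  rewrite (setUidPr _) ?sub1set //.
  have -> : (C :\ u == C) = false.
    by apply/negP=> /eqP CE; move: Cu; rewrite -CE setD11.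
  rewrite andbF; apply/negbTE; apply: contra Br => /andP[_ Cr].
  by rewrite -(perm_mem Cr) -key_u map_f // mem_enum.
by rewrite -/(Q _ _) QU1 // good_u setU11 setU1K // eqxx !andbT.
Qed.

(** A choice of one summand for each [B] in [P] is a set [C] on which [key] is injective with image
    [P]. So [C] determines [P], and of the sum over [P] only the condition [R (key @: C)] is
    left. *)
Lemma multilinear_expand (R : pred {set J}) :
  \sum_(P : {set J} | R P)
     M [seq \sum_(u | good u && (key u == B)) w u *: g u | B in P] =
  \sum_(C : {set T} | [&& [forall u in C, good u],
                          uniq [seq key u | u in C] & R (key @: C)])
     (\prod_(u in C) w u) *: M [seq g u | u in C].
Proof.
have keyE (C : {set T}) (P : {set J}) :
    perm_eq [seq key u | u in C] (enum P) =
    uniq [seq key u | u in C] && (key @: C == P).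
  apply/idP/andP=> [CP|[C_uniq /eqP <-]].
    split; first by rewrite (perm_uniq CP) enum_uniq.
    apply/eqP/setP=> B; rewrite -[RHS]mem_enum -(perm_mem CP).
    by rewrite mem_image_imset.
  apply: uniq_perm; rewrite ?enum_uniq // => B; rewrite mem_enum.
  exact: mem_image_imset.
transitivity (\sum_(P : {set J} | R P)
    \sum_(C : {set T} | [forall u in C, good u]
                        && perm_eq [seq key u | u in C] (enum P))
     (\prod_(u in C) w u) *: M [seq g u | u in C]).
  apply: eq_bigr => P _; rewrite -[X in M X]cats0 multilinear_expand_seq.
    by apply: eq_bigr => C _; rewrite cats0.
  exact: enum_uniq.
rewrite (exchange_big_dep (fun C : {set T} => [&& [forall u in C, good u],
    uniq [seq key u | u in C] & R (key @: C)])) /=; last first.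
  by move=> P C RP; rewrite keyE => /and3P[-> -> /eqP->].
apply: eq_bigr => C /and3P[goodC uniqC RC].
rewrite (big_pred1 (key @: C)) // => P; rewrite keyE goodC uniqC /=.
by rewrite eq_sym; apply: andb_idl => /eqP->.
Qed.

End Multilinear.

(** * Partitions and their refinements *)

Section Blocks.

Variables (T : finType) (s : {set {set T}}) (A : {set T}).
Hypothesis sA : partition s A.

Lemma partition_block_eq B1 B2 x :
  B1 \in s -> B2 \in s -> x \in B1 -> x \in B2 -> B1 = B2.
Proof.
have [_ triv _] := and3P sA => sB1 sB2 B1x B2x.
by rewrite -(def_pblock triv sB1 B1x) (def_pblock triv sB2 B2x).
Qed.

Lemma partition_block_sub B : B \in s -> B \subset A.
Proof. by rewrite -(cover_partition sA); apply: bigcup_sup. Qed.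

End Blocks.

Lemma partition_proper_block (T : finType) (s : {set {set T}}) (A B : {set T}) :
  partition s A -> s != [set A] -> B \in s -> B \proper A.
Proof.
move=> sA s_neq sB; rewrite properEneq (partition_block_sub sA sB) andbT.
apply: contraNneq s_neq => BA; apply/eqP/setP=> C; rewrite inE.
apply/idP/eqP=> [sC|->]; last by rewrite -BA.
have /set0Pn[x Cx] := partition_neq0 sA sC.
rewrite -BA; apply: (partition_block_eq sA sC sB Cx).
by rewrite BA (subsetP (partition_block_sub sA sC)).
Qed.

Lemma partition_not_set0 (T : finType) (s : {set {set T}}) (A : {set T}) :
  partition s A -> A != set0 -> s != set0.
Proof.
move=> sA; apply: contraNneq => s0.
by rewrite -(cover_partition sA) s0 /cover big_set0.
Qed.

Lemma partition_set1_block (T : finType) (A : {set T}) :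
  A != set0 -> partition [set A] A.
Proof.
move=> A0; rewrite /partition /cover big_set1 eqxx !inE eq_sym A0 andbT /=.
by apply/trivIsetP=> B C /set1P-> /set1P->; rewrite eqxx.
Qed.

Section Partitions.

Variable L : finType.
Implicit Types (A B : {set L}) (s : {set {set L}}) (r : {set {set {set L}}}).

(** A fine partition with its blocks grouped carries the same data as a coarse partition with a
    partition of each of its blocks. The right-hand side has the form of the index set in
    [multilinear_expand], with [cover] as [key]. *)
Lemma partition_cover_imset r A :
  partition r (cover r) && partition (cover r) A =
  [&& [forall s in r, partition s (cover s)], uniq [seq cover s | s in r]
    & partition (cover @: r) A].
Proof.
rewrite -/(dinjectiveb _ (mem r)).
apply/andP/and3P => [[rP sP]|[/forall_inP goodr /dinjectiveP cinj cP]].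
  have [cP cinj] := partition_partition sP rP;
  split=> //; last exact/dinjectiveP.
  apply/forall_inP=> s rs; have [_ /trivIsetP triv s0] := and3P sP.
  have subs : {subset s <= cover r}.
    by apply/subsetP; apply: (partition_block_sub rP).
  rewrite /partition eqxx /= (contra (subs _)) // andbT.
  by apply/trivIsetP=> B1 B2 /subs sB1 /subs; apply: triv.
(* A point determines the block containing it and the group containing that block. *)
have s_eq s1 s2 B1 B2 x : s1 \in r -> s2 \in r -> B1 \in s1 -> B2 \in s2 ->
    x \in B1 -> x \in B2 -> s1 = s2 /\ B1 = B2.
  move=> rs1 rs2 sB1 sB2 B1x B2x.
  have E : s1 = s2.
    apply: cinj => //; apply: (partition_block_eq cP (x := x));
      rewrite ?imset_f //; apply/bigcupP.
      by exists B1.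
    by exists B2.
  split=> //; rewrite -E in sB2.
  exact: (partition_block_eq (goodr _ rs1) sB1 sB2 B1x B2x).
have B_ex s B : s \in r -> B \in s -> exists x, x \in B.
  by move=> rs sB; apply/set0Pn; apply: partition_neq0 (goodr _ rs) sB.
split; apply/and3P; split=> //.
- apply/trivIsetP=> s1 s2 rs1 rs2;
  apply: contraR => /pred0Pn[B /andP[/= sB1 sB2]].
  have [x Bx] := B_ex _ _ rs1 sB1.
  by have [-> _] := s_eq _ _ _ _ _ rs1 rs2 sB1 sB2 Bx Bx.
- apply/negP=> r0; have := partition_neq0 cP (imset_f cover r0).
  by rewrite /cover big_set0 eqxx.
- rewrite -(cover_partition cP); apply/eqP/setP=> x.
  apply/bigcupP/bigcupP=> [[B /bigcupP[s rs sB] Bx]|[C /imsetP[s rs ->]]].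
    by exists (cover s); rewrite ?imset_f //; apply/bigcupP; exists B.
  case/bigcupP=> B sB Bx; exists B => //.
  by apply/bigcupP; exists s.
- apply/trivIsetP=> B1 B2 /bigcupP[s1 rs1 sB1] /bigcupP[s2 rs2 sB2].
  apply: contraR => /pred0Pn[x /andP[/= Bx1 Bx2]].
  by have [_ ->] := s_eq _ _ _ _ _ rs1 rs2 sB1 sB2 Bx1 Bx2.
- by apply/bigcupP=> -[s rs /(B_ex _ _ rs)[x]]; rewrite inE.
Qed.

Variables (K : fieldType) (V : lmodType K) (M : seq V -> V).
Hypothesis M_ml : symmetric_multilinear M.

(** Expanding chooses a partition of every block [B]; together these form the fine partition
    [cover r]. [R] carries a condition on the coarse partition through the regrouping. *)
Lemma double_partition (g : {set {set L}} -> V) (R : pred {set {set L}}) A :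
  \sum_(P | partition P A && R P)
     M [seq \sum_(s | partition s B) g s | B in P] =
  \sum_(s | partition s A) \sum_(r | partition r s && R (cover @: r))
     M [seq g s' | s' in r].
Proof.
have H := multilinear_expand M_ml (@cover L)
  (fun s => partition s (cover s)) (fun=> 1) g (fun P => partition P A && R P).
transitivity (\sum_(P | partition P A && R P) M [seq \sum_(s : {set {set L}} |
    partition s (cover s) && (cover s == B)) 1 *: g s | B in P]).
  apply: eq_bigr => P _; congr M; apply: eq_map => B.
  apply: eq_big => [s|s _]; last by rewrite scale1r.
  apply/idP/andP=> [sB|[sB /eqP <-//]].
  by rewrite (cover_partition sB) eqxx.
rewrite {}H [RHS](exchange_big_dep (fun r => (partition r (cover r) &&
  partition (cover r) A) && R (cover @: r))) /=; last first.
  by move=> s r sA /andP[rs ->]; rewrite (cover_partition rs) rs sA.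
apply: eq_big => [r|r].
  by rewrite partition_cover_imset -!andbA.
case/and3P=> gr ur /andP[cP Rr].
have /andP[rP sP] : partition r (cover r) && partition (cover r) A.
  by rewrite partition_cover_imset gr ur.
rewrite big1 // scale1r (big_pred1 (cover r)) => [//|s].
apply/and3P/eqP=> [[_ rs _]|->]; last by split.
by rewrite (cover_partition rs).
Qed.

End Partitions.

(** * Moments and cumulants over index sets *)

Section Moments.

Variables (K : fieldType) (V : lmodType K) (dot star : comAlgProduct V).
Local Notation kappa := (cumulant dot star).

Lemma cumulant1 x : kappa [:: x] = x.
Proof.
rewrite cumulantE // big_seq1 big_pred0 ?subr0 // => P.
apply/negP=> /andP[PT /negP[]]; apply/eqP/setP=> B; rewrite inE.
have PE C : C \in P -> C = setT.
  move=> PC; have /set0Pn[i Ci] := partition_neq0 PT PC.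
  by apply/setP=> j; rewrite inE (ord1 j) -(ord1 i).
apply/idP/eqP=> [/PE//|->].
have: (ord0 : 'I_(size [:: x])) \in cover P by rewrite (cover_partition PT) inE.
by case/bigcupP=> C PC _; rewrite -(PE _ PC).
Qed.

(** This is [cumulantP] transported along an enumeration of [D]. That formula excludes the empty
    sequence; for empty [D] the two sides are the units of [star] and [dot], hence the
    hypothesis. *)
Lemma star_cumulants (I : finType) (D : {set I}) (y : I -> V) :
    (D = set0 -> punit dot = punit star) ->
  \big[star/punit star]_(i in D) y i =
  \sum_(P | partition P D)
     \big[dot/punit dot]_(B in P) kappa [seq y i | i in B].
Proof.
move=> unitE; have [D0|D_neq0] := eqVneq D set0.
  rewrite D0 big_set0 (big_pred1 set0) ?big_set0 ?unitE // => P.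
  by rewrite partition_set0.
pose s := [seq y i | i in D].
have sz_s : size s = #|D| by rewrite size_map -cardE.
pose f (i : 'I_(size s)) : I := enum_val (cast_ord sz_s i).
have f_inj : injective f by move=> i j /enum_val_inj/cast_ord_inj.
have fT : f @: setT = D.
  apply/setP=> x; apply/imsetP/idP=> [[i _ ->]|Dx]; first exact: enum_valP.
  exists (cast_ord (esym sz_s) (enum_rank_in Dx x)) => //.
  by rewrite /f cast_ordKV enum_rankK_in.
have nth_f (i : 'I_(size s)) : s`_i = y (f i).
  have [x0 _] := set0Pn _ D_neq0.
  rewrite /f (enum_val_nth x0) (nth_map x0) //= -?cardE -?sz_s //.
transitivity (\big[star/punit star]_(x <- s) x).
  by rewrite big_map big_enum.
rewrite (cumulantP dot star); last by rewrite -size_eq0 sz_s cards_eq0.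
have preK (B : {set I}) : B \subset D -> f @: (f @^-1: B) = B.
  move/subsetP=> BD; apply/setP=> x; apply/imsetP/idP=> [[i]|Bx].
    by rewrite inE => Bfi ->.
  have := BD _ Bx; rewrite -fT => /imsetP[i _ xE]; exists i => //.
  by rewrite inE -xE.
have imK (B : {set 'I_(size s)}) : f @^-1: (f @: B) = B.
  by apply/setP=> i; rewrite inE mem_imset.
rewrite [RHS](reindex_onto (fun P : {set {set 'I_(size s)}} =>
    [set f @: (B : {set _}) | B in P])
  (fun P : {set {set I}} => [set f @^-1: (B : {set _}) | B in P])) /=.
  apply: eq_big => [P|P PT].
    rewrite -fT imset_partition // -imset_comp.
    by rewrite (eq_imset _ (g := id)) ?imset_id ?eqxx ?andbT.
  rewrite big_imset /=; last by move=> B C _ _; apply: imset_inj.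
  apply: eq_bigr => B _; rewrite /image_mem (eq_map nth_f) (map_comp y f).
  apply/cumulant_perm/perm_map/uniq_perm.
  - by rewrite map_inj_uniq ?enum_uniq.
  - exact: enum_uniq.
  move=> x; rewrite mem_enum; apply/mapP/imsetP => [] [i Bi ->]; exists i => //.
    by rewrite -(mem_enum B).
  by rewrite mem_enum.
move=> P PD; rewrite -imset_comp -[RHS]imset_id; apply: eq_in_imset => B PB.
exact/preK/(partition_block_sub PD).
Qed.

Variables (L : finType) (a : L -> V).
Implicit Types (s P : {set {set L}}) (A : {set L}).

(** The moment-cumulant formula in each block of [P], then distributivity of [dot]: partitioning
    every block of [P] amounts to partitioning [A] more finely than [P]. *)
Lemma refined_moments A P : partition P A ->
  \big[dot/punit dot]_(B in P) \big[star/punit star]_(x in B) a x =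
  \sum_(s | partition s A && [forall b in s, exists B in P, b \subset B])
     \big[dot/punit dot]_(b in s) kappa [seq a x | x in b].
Proof.
move=> PA; pose F s := \big[dot/punit dot]_(b in s) kappa [seq a x | x in b].
have := double_partition (symmetric_multilinear_big dot) F (pred1 P) A.
rewrite (big_pred1 P) => [|Q]; last by rewrite andb_idl // => /eqP->.
rewrite big_map big_enum => E.
transitivity (\big[dot/punit dot]_(B in P) \sum_(s | partition s B) F s).
  apply: eq_bigr => B PB; apply: star_cumulants => B0.
  by have := partition_neq0 PA PB; rewrite B0 eqxx.
rewrite {}E [RHS]big_mkcondr /=; apply: eq_bigr => s sA.
have E r : partition r s ->
    \big[dot/punit dot]_(x <- [seq F s' | s' in r]) x = F s.
  move=> rs; have [/eqP cr tr _] := and3P rs.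
  by rewrite big_map big_enum /= /F -[in RHS]cr big_trivIset.
under eq_bigr => r /andP[rs _] do rewrite E //.
(* A grouping of [s] with unions [P] exists only if [s] refines [P], and it is then [blk @: P]. *)
pose blk (B : {set L}) := [set b in s | b \subset B].
have sub_eq (b B B' : {set L}) : B \in P -> B' \in P -> b \in s ->
   b \subset B -> b \subset B' -> B = B'.
  move=> PB PB' sb bB bB'; have /set0Pn[x bx] := partition_neq0 sA sb.
  by apply: (partition_block_eq PA PB PB' (x := x)); apply: (subsetP _ x bx).
have PA' B : B \in P -> B \subset A := partition_block_sub PA (B := B).
have cover_blk : [forall b in s, exists B in P, b \subset B] ->
   {in P, forall B, cover (blk B) = B}.
  move/forall_inP=> sP B PB; apply/setP=> x; apply/bigcupP/idP.
    by case=> b; rewrite inE => /andP[_ /subsetP bB] /bB.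
  move=> Bx; have : x \in cover s.
    by rewrite (cover_partition sA) (subsetP (PA' _ PB)).
  case/bigcupP=> b sb bx; exists b => //; rewrite inE sb.
  have /exists_inP[B' PB' bB'] := sP _ sb.
  by rewrite (partition_block_eq PA PB PB' Bx (subsetP bB' _ bx)).
case: ifP => [sP|sP]; last first.
  apply: big_pred0 => r; apply/negP=> /andP[rs /eqP rP].
  move/negP: sP; apply; apply/forall_inP=> b sb.
  have: b \in cover r by rewrite (cover_partition rs).
  case/bigcupP=> t rt tb; apply/exists_inP; exists (cover t).
    by rewrite -rP imset_f.
  exact: bigcup_sup.
rewrite (big_pred1 (blk @: P)) // => r; apply/andP/eqP=> [[rs /eqP rP]|->].
  have cov_sub t b : t \in r -> b \in t -> b \subset cover t.
    by move=> _; apply: bigcup_sup.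
  have rE t : t \in r -> t = blk (cover t).
    move=> rt; apply/setP=> b; rewrite inE; apply/idP/andP=> [tb|[sb bt]].
      by rewrite cov_sub // (subsetP (partition_block_sub rs rt)).
    have: b \in cover r by rewrite (cover_partition rs).
    case/bigcupP=> t' rt' tb'.
    have /set0Pn[x bx] := partition_neq0 sA sb.
    have /bigcupP[b2 tb2 b2x] := subsetP bt x bx.
    have sb2 := subsetP (partition_block_sub rs rt) _ tb2.
    by rewrite (partition_block_eq sA sb sb2 bx b2x).
  rewrite -rP -imset_comp -[LHS]imset_id.
  by apply: eq_in_imset => t rt; apply: rE.
have covP := cover_blk sP; split; last first.
  rewrite -imset_comp; apply/eqP; rewrite -[RHS]imset_id.
  exact: eq_in_imset.
apply/and3P; split.
- apply/eqP/setP=> b; apply/bigcupP/idP.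
    by case=> _ /imsetP[B PB ->]; rewrite inE => /andP[].
  move=> sb; have /exists_inP[B PB bB] := forall_inP sP _ sb.
  by exists (blk B); rewrite ?imset_f // inE sb.
- apply/trivIsetP=> _ _ /imsetP[B PB ->] /imsetP[B' PB' ->].
  apply: contraR => /pred0Pn[b /andP[]]; rewrite /= !inE.
  move=> /andP[sb bB] /andP[_ bB'].
  by rewrite (sub_eq b B B').
- apply/imsetP=> -[B PB /esym blk0]; have := covP _ PB.
  rewrite blk0 /cover big_set0 => /esym B0.
  by have := partition_neq0 PA PB; rewrite B0 eqxx.
Qed.

End Moments.

(** * Leaf labels of a set of trees *)

Section Flatten.

Variables (T L : finType) (l : T -> seq L).
Local Notation support t := [set x in l t].

Lemma uniq_flattenP (r : seq T) : uniq r ->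
  reflect ({in r, forall t, uniq (l t)} /\
           {in r &, forall t u, u != t -> [disjoint support t & support u]})
    (uniq (flatten [seq l t | t <- r])).
Proof.
elim: r => [|t r IH] /=; first by left.
case/andP=> rt /IH{}IH; rewrite cat_uniq.
apply: (iffP and3P) => [[lt_u tr /IH[r_u r_d]]|[r_u r_d]].
  have tD u : u \in r -> [disjoint support t & support u].
    move=> ru; apply/pred0P=> x; rewrite /= !inE; apply/negP=> /andP[tx ux].
    move/hasP: tr; apply; exists x => //.
    by apply/flatten_mapP; exists u.
  split=> [u|u v]; rewrite !inE; first by case/predU1P=> [->|/r_u].
  move=> /predU1P[->|ru] /predU1P[->|rv]; rewrite ?eqxx //.
  - by move=> _; apply: tD.
  - by move=> _; rewrite disjoint_sym; apply: tD.
  exact: r_d.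
split; first by apply: r_u; rewrite mem_head.
  apply/hasP=> -[x /flatten_mapP[u ru ux] tx].
  have := r_d t u; rewrite !inE eqxx ru orbT => /(_ isT isT).
  have [ut|_ /(_ isT)/pred0P/(_ x)] := eqVneq u t.
    by rewrite -ut ru in rt.
  by rewrite /= !inE ux; have -> : x \in l t by [].
apply/IH; split=> [u ru|u v ru rv]; first by apply: r_u; rewrite inE ru orbT.
by apply: r_d; rewrite inE ?ru ?rv orbT.
Qed.

(** Turns bijective labelling of the leaves into the index condition of [multilinear_expand], with
    supports as keys. The hypothesis excludes empty supports, which no partition contains. *)
Lemma perm_flatten_partition (C : {set T}) (b : {set L}) :
  {in C, forall t, l t != [::]} ->
  perm_eq (flatten [seq l t | t in C]) (enum b) =
  [&& [forall t in C, uniq (l t)], uniq [seq support t | t in C]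
    & partition [set support t | t in C] b].
Proof.
move=> l_neq0; rewrite -/(dinjectiveb (fun t => support t) (mem C)).
have support0 t : t \in C -> support t != set0.
  move/l_neq0; rewrite -!size_eq0; case: (l t) => // x s _.
  by apply/set0Pn; exists x; rewrite !inE eqxx.
have memE x : (x \in flatten [seq l t | t in C]) =
    (x \in cover [set support t | t in C]).
  apply/flatten_mapP/bigcupP=> [[t]|[_ /imsetP[t Ct ->]]].
    by rewrite mem_enum => Ct tx; exists (support t); rewrite ?imset_f ?inE.
  by rewrite inE; exists t; rewrite ?mem_enum.
apply/idP/and3P=> [Cb|[/forall_inP C_u /dinjectiveP C_inj Cb]].
  have := perm_uniq Cb; rewrite enum_uniq => /uniq_flattenP[].
    exact: enum_uniq.
  move=> C_u C_d; have [||cP C_inj] := @indexed_partition _ _ (mem C)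
      (fun t => support t).
  - by move=> t u Ct Cu; apply: C_d; rewrite mem_enum.
  - exact: support0.
  split.
  - by apply/forall_inP=> t Ct; apply: C_u; rewrite mem_enum.
  - exact/dinjectiveP.
  suff <- : cover [set support t | t in C] = b by [].
  by apply/setP=> x; rewrite -memE (perm_mem Cb) mem_enum.
apply: uniq_perm; rewrite ?enum_uniq //; last first.
  by move=> x; rewrite memE mem_enum (cover_partition Cb).
apply/uniq_flattenP; rewrite ?enum_uniq //; split=> [t|t u]; rewrite !mem_enum.
  exact: C_u.
move=> Ct Cu ut.
have [_ /trivIsetP triv _] := and3P Cb.
by apply: triv; rewrite ?imset_f ?(inj_in_eq C_inj) // eq_sym.
Qed.

End Flatten.

(** * Signed sums over trees and forests *)

Section Trees.

Variables (L : finType) (I : eqType) (c : L -> I).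

Lemma tree_leavesS h (C : {set tree L h}) :
  @tree_leaves L h.+1 (inr C) = flatten [seq tree_leaves u | u in C].
Proof. by []. Qed.

Lemma tree_leaves_leaf h x : tree_leaves (leaf (L := L) h x) = [:: x].
Proof. by case: h. Qed.

Lemma leaf_size h (t : tree L h) :
  tree_reduced t -> [exists x, t == leaf h x] = (size (tree_leaves t) == 1)%N.
Proof.
move=> t_red; apply/existsP/idP=> [[x /eqP->]|].
  by rewrite tree_leaves_leaf.
case: h t t_red => [|h] t; first by exists t.
case: t => [x|C] C_red /eqP C1; first by exists x.
by have := @reduced_height _ h.+1 (inr C) C_red; rewrite C1.
Qed.

Lemma tree_leaves_neq0 h (t : tree L h) :
  tree_reduced t -> tree_leaves t != [::].
Proof. by move/reduced_height; case: (tree_leaves t). Qed.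

Lemma size_leaves_order h (t : tree L h) :
  (size (tree_leaves t) <= tree_order t)%N.
Proof.
elim: h t => [|h IH] // [x|C] //=.
rewrite size_flatten /shape -map_comp sumnE big_map big_enum /=.
by apply: leqW; apply: leq_sum.
Qed.

Definition leaf_set h (t : tree L h) : {set L} := [set x in tree_leaves t].

Definition good_tree h (t : tree L h) :=
  [&& tree_reduced t, tree_mixing c t & uniq (tree_leaves t)].

Definition mono (b : {set L}) := [forall x in b, forall y in b, c x == c y].

(* The partitions of b into the leaf sets of the children of the root of a    *)
(* mixing tree with leaf set b.                                               *)
Definition admissible (b : {set L}) (s : {set {set L}}) :=
  [&& partition s b, s != [set b] & [forall B in s, #|B| == 1%N] ==> ~~ mono b].

(** Cut the tree at its root. Having at least two children means that the partition is not
    [[set b]]; a child is a leaf exactly when its block is a singleton, so mixing at the root is the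
    last clause of [admissible]. *)
Lemma good_nodeE h (C : {set tree L h}) b : b != set0 ->
  good_tree (inr C : tree L h.+1) && (leaf_set (inr C : tree L h.+1) == b) =
  [&& [forall u in C, good_tree u], uniq [seq leaf_set u | u in C]
    & admissible b [set leaf_set u | u in C]].
Proof.
move=> b0.
have [C_red|C_red] := boolP [forall u in C, tree_reduced u]; last first.
  rewrite /good_tree /= (negPf C_red) andbF /=; apply/esym/negbTE.
  apply: contra C_red => /andP[/forall_inP C_good _]; apply/forall_inP=> u Cu.
  by have /and3P[] := C_good u Cu.
have permE : uniq (tree_leaves (inr C : tree L h.+1)) &&
    (leaf_set (inr C : tree L h.+1) == b) =
    perm_eq (flatten [seq tree_leaves u | u in C]) (enum b).
  apply/andP/idP=> [[C_u /eqP <-]|Cb].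
    by apply: uniq_perm => //; rewrite ?enum_uniq // => x; rewrite mem_enum inE.
  rewrite /leaf_set !tree_leavesS (perm_uniq Cb) enum_uniq; split=> //.
  by apply/eqP/setP=> x; rewrite inE (perm_mem Cb) mem_enum.
rewrite /good_tree -!andbA permE perm_flatten_partition; last first.
  by move=> u Cu; apply/tree_leaves_neq0/(forall_inP C_red).
rewrite /= C_red /= /admissible -/(leaf_set _).
have -> : [forall u in C,
    [&& tree_reduced u, tree_mixing c u & uniq (tree_leaves u)]] =
  [forall u in C, tree_mixing c u] && [forall u in C, uniq (tree_leaves u)].
  apply/forall_inP/andP=> [C_good|[/forall_inP C_mix /forall_inP C_u] u Cu].
    by split; apply/forall_inP=> u /C_good/and3P[].
  by rewrite (forall_inP C_red) ?C_mix ?C_u.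
set mix := [forall u in C, tree_mixing c u].
set C_u := [forall u in C, uniq (tree_leaves u)].
set P := [set leaf_set u | u in C].
change [seq [set x in tree_leaves t] | t in C] with [seq leaf_set t | t in C].
have [Cuniq|] := boolP C_u; last by rewrite !andbF.
have [|] := boolP (uniq [seq leaf_set u | u in C]); last by rewrite !andbF.
move=> C_uk; have /dinjectiveP C_inj : dinjectiveb (@leaf_set h) (mem C) by [].
have [Pb|] := boolP (partition P b); last by rewrite !andbF.
rewrite !andbT /= andbA andbC; congr (_ && _).
have -> : (1 < #|C|)%N = (P != [set b]).
  have -> : #|C| = #|P| by rewrite (card_in_imset C_inj).
  rewrite ltn_neqAle card_gt0 (partition_not_set0 Pb b0).
  rewrite andbT eq_sym; congr (~~ _); apply/cards1P/eqP=> [[B PB]|->].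
    by have := cover_partition Pb; rewrite PB /cover big_set1 => ->.
  by exists b.
congr (_ && _).
have -> : [forall B in P, #|B| == 1%N] =
    [forall u in C, [exists x, u == leaf h x]].
  have cardE u : u \in C -> (#|leaf_set u| == 1%N) = [exists x, u == leaf h x].
    move=> Cu; rewrite leaf_size ?(forall_inP C_red) // cardsE.
    by rewrite (card_uniqP _) ?(forall_inP Cuniq).
  apply/forall_inP/forall_inP=> [H u Cu|H B /imsetP[u Cu ->]].
    by rewrite -cardE // H ?imset_f.
  by rewrite cardE ?H.
have [/forall_inP C_leaf|//] :=
  boolP [forall u in C, [exists x, u == leaf h x]]; rewrite /=.
have leafE x : (leaf h x \in C) = (x \in b).
  rewrite -(cover_partition Pb); apply/idP/bigcupP=> [Cx|[_ /imsetP[u Cu ->]]].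
    exists (leaf_set (leaf h x)); first exact: imset_f.
    by rewrite inE tree_leaves_leaf inE.
  have /existsP[y /eqP uy] := C_leaf u Cu.
  by rewrite inE uy tree_leaves_leaf inE => /eqP->; rewrite -uy.
rewrite /mono negb_forall; apply: eq_existsb => x.
rewrite negb_imply negb_forall; apply/existsP/andP.
  case=> y; rewrite !leafE => /and3P[bx by_ cxy]; split=> //.
  by apply/existsP; exists y; rewrite negb_imply by_.
case=> bx /existsP[y]; rewrite negb_imply => /andP[by_ cxy].
by exists y; rewrite !leafE bx by_.
Qed.

Variables (K : fieldType) (V : lmodType K) (dot star : comAlgProduct V).
Variable a : L -> V.
Local Notation kappa := (cumulant dot star).

(* order + leaves has the parity of the weight (order - leaves), and avoids   *)
(* truncated subtraction.                                                     *)
Definition tree_sign h (t : tree L h) : K :=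
  (-1) ^+ (tree_order t + size (tree_leaves t)).

(** This is tau(b) of the outline, restricted to trees of height at most [h]. *)
Definition tree_sum h (b : {set L}) : V :=
  \sum_(t : tree L h | good_tree t && (leaf_set t == b))
     tree_sign t *: tree_cumulant dot star a t.

(** The root adds one vertex and no leaf. *)
Lemma tree_signS h (C : {set tree L h}) :
  tree_sign (inr C : tree L h.+1) = - \prod_(u in C) tree_sign u.
Proof.
rewrite /tree_sign /= prodrXr addSn exprS mulN1r big_split /=.
by rewrite size_flatten /shape -map_comp sumnE big_map big_enum.
Qed.

(** A tree is a single leaf or a root over subtrees; multilinearity of [kappa] sums over each
    subtree separately, and the minus sign is that of the root. *)
Lemma tree_sum_node h (b : {set L}) : b != set0 ->
  tree_sum h.+1 b = \sum_(x | [set x] == b) a x -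
    \sum_(s | admissible b s) kappa [seq tree_sum h B | B in s].
Proof.
move=> b0; rewrite /tree_sum big_sumType; congr (_ + _).
  apply: eq_big => [x|x _].
    rewrite /good_tree /leaf_set /=; congr (_ == _).
    by apply/setP=> y; rewrite !inE.
  by rewrite /tree_sign /= -signr_odd scale1r.
rewrite (multilinear_expand (symmetric_multilinear_cumulant dot star)).
rewrite -sumrN; apply: eq_big => [C|C _]; first exact: good_nodeE.
by rewrite tree_signS scaleNr.
Qed.

Lemma set1_neq0 (x : L) : [set x] != set0.
Proof. by apply/set0Pn; exists x; rewrite set11. Qed.

Lemma admissible_set1 x s : admissible [set x] s = false.
Proof.
apply/negP=> /and3P[sx s_neq _].
have /set0Pn[B sB] := partition_not_set0 sx (set1_neq0 x).
have := proper_card (partition_proper_block sx s_neq sB).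
rewrite cards1 ltnS leqn0 cards_eq0.
by rewrite (negPf (partition_neq0 sx sB)).
Qed.

Lemma tree_sum_set1 h x : tree_sum h [set x] = a x.
Proof.
have eq1 y : ([set y] == [set x]) = (y == x) by rewrite (inj_eq set1_inj).
case: h => [|h]; last first.
  rewrite tree_sum_node ?set1_neq0 // (big_pred1 x) // big_pred0 ?subr0 //.
  exact: admissible_set1.
rewrite /tree_sum (big_pred1 x) => [|y].
  by rewrite /tree_sign -signr_odd scale1r.
rewrite /good_tree /leaf_set /= -eq1; congr (_ == _).
by apply/setP=> z; rewrite !inE.
Qed.

(** Blocks of an admissible partition are proper subsets of [b], so size and height bound drop
    together. This lets the recursion, which lowers the height by one, be read at a single
    height. *)
Lemma tree_sum_stable h (b : {set L}) : b != set0 -> (#|b| <= h.+1)%N ->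
  tree_sum h.+1 b = tree_sum h b.
Proof.
elim: h b => [|h IH] b b0 bh.
  have /cards1P[x ->] : #|b| == 1%N by rewrite eqn_leq bh card_gt0.
  by rewrite !tree_sum_set1.
rewrite tree_sum_node // [RHS]tree_sum_node //; congr (_ - _).
apply: eq_bigr => s /and3P[sb s_neq _]; congr kappa.
apply/eq_in_map => B; rewrite mem_enum => sB.
rewrite IH ?(partition_neq0 sb sB) // -ltnS.
exact: leq_trans (proper_card (partition_proper_block sb s_neq sB)) bh.
Qed.

(* Isolating the one-block partition, whose term is [tree_sum h b] itself,    *)
(* turns the recursion [tree_sum_node] into this identity.                    *)
Lemma sum_kappa_tree_sum h (b : {set L}) : b != set0 -> (#|b| <= h.+1)%N ->
  \sum_(s | partition s b) kappa [seq tree_sum h B | B in s] =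
  if mono b then kappa [seq a x | x in b] else 0.
Proof.
move=> b0 bh; rewrite (bigD1 [set b]) ?partition_set1_block //=.
rewrite /image_mem enum_set1 /= cumulant1 -tree_sum_stable //.
rewrite tree_sum_node //.
pose mixed (s : {set {set L}}) := [forall B in s, #|B| == 1%N] ==> ~~ mono b.
rewrite [X in _ + X](bigID mixed) /=.
have -> : \sum_(s | (partition s b && (s != [set b])) && mixed s)
    kappa [seq tree_sum h B | B in s] =
  \sum_(s | admissible b s) kappa [seq tree_sum h B | B in s].
  by apply: eq_bigl => s; rewrite -andbA.
(* The admissible partitions cancel. There remain the one-leaf tree and the partitions that are not
   [mixed]: at most the one into singletons, and only if [b] is [mono]. *)
rewrite addrA subrK /mixed; case: ifP => [b_mono|b_mono]; last first.
  rewrite !big_pred0 ?addr0 // => [s|x]; first by rewrite implybT andbF.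
  apply/negbTE; apply: contraFneq b_mono => <-.
  by apply/forall_inP=> y /set1P->; apply/forall_inP=> z /set1P->.
have [/cards1P[x bx]|b1] := boolP (#|b| == 1%N).
  rewrite bx (big_pred1 x) => [|y]; last by rewrite (inj_eq set1_inj).
  rewrite big_pred0 => [|s].
    by rewrite addr0 /image_mem enum_set1 cumulant1.
  apply/negbTE; rewrite negb_imply negbK -bx.
  apply/negP=> /andP[/andP[sb s_neq] _].
  have /set0Pn[B sB] := partition_not_set0 sb b0.
  have := proper_card (partition_proper_block sb s_neq sB).
  by rewrite bx cards1 ltnS leqn0 cards_eq0 (negPf (partition_neq0 sb sB)).
rewrite big_pred0 => [|x]; last first.
  by apply/negbTE; apply: contraNneq b1 => <-; rewrite cards1.
rewrite add0r (big_pred1 [set [set x] | x in b]) => [|s].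
  apply/cumulant_perm; rewrite /image_mem.
  have enumE :
      perm_eq (enum [set [set x] | x in b]) [seq [set x] | x <- enum b].
    apply: uniq_perm; rewrite ?enum_uniq ?(map_inj_uniq set1_inj) ?enum_uniq //.
    by move=> B; rewrite mem_enum -mem_image_imset.
  rewrite (permPl (perm_map _ enumE)) -map_comp.
  have -> : [seq ([eta tree_sum h] \o [eta set1]) x | x <- enum b] =
      map a (enum b).
    by apply: eq_map => x; apply: tree_sum_set1.
  exact: perm_refl.
rewrite negb_imply negbK andbT.
apply/andP/eqP=> [[/andP[sb _] /forall_inP s1]|->].
  have sP x : x \in b -> [set x] \in s.
    rewrite -{1}(cover_partition sb) => /bigcupP[B sB].
    by have /cards1P[y By] := s1 B sB; rewrite By => /set1P->; rewrite -By.
  apply/setP=> B; apply/idP/imsetP=> [sB|[x bx ->]]; last exact: sP.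
  have /cards1P[x Bx] := s1 B sB; exists x => //.
  by have /subsetP := partition_block_sub sb sB; apply; rewrite Bx set11.
split; last by apply/forall_inP=> _ /imsetP[x _ ->]; rewrite cards1.
apply/andP; split; last first.
  apply: contraNneq b1 => bE; have : b \in [set b] by rewrite set11.
  by rewrite -bE => /imsetP[x _ ->]; rewrite cards1.
apply/and3P; split.
- apply/eqP/setP=> x; apply/bigcupP/idP=> [[_ /imsetP[y yb ->] /set1P->] //|xb].
  by exists [set x]; rewrite ?imset_f ?set11.
- apply/trivIsetP=> _ _ /imsetP[x _ ->] /imsetP[y _ ->].
  by rewrite (inj_eq set1_inj) disjoints1 inE.
- by apply/imsetP=> -[x _ /esym x0]; have := set1_neq0 x; rewrite x0 eqxx.
Qed.

(** An element of [b] names the block. The empty set is [mono], yet lies in no block when [L] is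
    empty. *)
Lemma monoP (b : {set L}) : b != set0 ->
  mono b = [exists B in preim_partition c setT, b \subset B].
Proof.
case/set0Pn=> x bx; apply/forall_inP/exists_inP=> [b_mono|[_ /imsetP[y _ ->]]].
  exists [set y in setT | c x == c y]; first by apply: imset_f.
  by apply/subsetP=> y yb; rewrite !inE (forall_inP (b_mono x bx)).
move/subsetP=> bP u /bP; rewrite !inE /= => /eqP <-.
by apply/forall_inP=> v /bP; rewrite !inE.
Qed.

Lemma forest_sum (unitE : [set: L] = set0 -> punit dot = punit star) :
  \sum_(F : forest L | reduced_forest F && mixing_forest c F)
     (-1) ^+ forest_weight F *: forest_cumulant dot star a F =
  \big[dot/punit dot]_(B in preim_partition c setT)
     \big[star/punit star]_(x in B) a x.
Proof.
rewrite (refined_moments _ _ _ (preim_partitionP c setT)).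
(* Forests are sorted by the partition that the leaf sets of their trees form. *)
transitivity (\sum_(s | partition s [set: L])
    \big[star/punit star]_(B in s) tree_sum #|L| B).
  pose R s := partition s [set: L].
  have := multilinear_expand (symmetric_multilinear_big star)
    (@leaf_set #|L|) (@good_tree #|L|) (@tree_sign #|L|)
    (@tree_cumulant L K V dot star a #|L|) R.
  rewrite /=; under eq_bigr => s _ do rewrite big_map big_enum /=.
  move=> ->; apply: eq_big => [F|F /andP[/andP[F_leaves _] _]].
    rewrite /reduced_forest /mixing_forest /R.
    have [F_red|F_red] := boolP [forall t in F, tree_reduced t]; last first.
      rewrite andbF; apply/esym/negbTE; apply: contra F_red.
      case/and3P=> F_good _ _.
      by apply/forall_inP=> t Ft; have /and3P[] := forall_inP F_good t Ft.
    have enumLT : enum L = enum [set: L] by apply: eq_enum => x; rewrite !inE.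
    rewrite andbT /forest_leaves enumLT perm_flatten_partition; last first.
      by move=> t Ft; apply/tree_leaves_neq0/(forall_inP F_red).
    rewrite andbC andbA; congr (_ && _).
    apply/andP/forall_inP=> [[/forall_inP F_mix /forall_inP F_u] t Ft|F_good].
      by rewrite /good_tree F_mix ?F_u ?(forall_inP F_red).
    by split; apply/forall_inP=> t /F_good/and3P[].
  rewrite /forest_cumulant big_map big_enum /=; congr (_ *: _).
  rewrite /tree_sign prodrXr /forest_weight /forest_order /forest_leaves.
  rewrite size_flatten /shape -map_comp sumnE big_map big_enum /= big_split /=.
  (* The subtraction in the weight is not truncated, since a tree has at least as many vertices as
     leaves. *)
  rewrite -signr_odd oddB; last first.
    by apply: leq_sum => t _; apply: size_leaves_order.
  by rewrite -oddD signr_odd.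
(* The moment-cumulant formula with the blocks of [s] as indices and their tree sums as
   arguments. *)
have expand s : partition s setT ->
    \big[star/punit star]_(B in s) tree_sum #|L| B =
    \sum_(r | partition r s) \big[dot/punit dot]_(s' in r)
       kappa [seq tree_sum #|L| B | B in s'].
  move=> sT; apply: star_cumulants => s0; apply: unitE.
  by rewrite -(cover_partition sT) s0 /cover big_set0.
rewrite (eq_bigr _ expand).
have := double_partition (symmetric_multilinear_big dot)
  (fun s => kappa [seq tree_sum #|L| B | B in s]) xpredT setT.
rewrite /=; under eq_bigr => s _ do rewrite big_map big_enum /=.
under [X in _ = X]eq_bigr => s _ do
  (under eq_bigr => r _ do rewrite big_map big_enum /=).
under [X in _ = X]eq_bigr => s _ do (under eq_bigl => r do rewrite andbT).
move=> <-; rewrite (eq_bigl (fun s => partition s setT)); last first.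
  by move=> s; rewrite andbT.
rewrite [RHS]big_mkcondr /=; apply: eq_bigr => s sT.
have blockE B : B \in s ->
    \sum_(s' | partition s' B) kappa [seq tree_sum #|L| C | C in s'] =
    if mono B then kappa [seq a x | x in B] else 0.
  move=> sB; apply: sum_kappa_tree_sum; first exact: partition_neq0 sT sB.
  (* The height bound [#|L|] built into [forest] is large enough for every block. *)
  exact/leqW/max_card.
rewrite (eq_bigr _ blockE); case: ifP => [/forall_inP s_mono|/negbT].
  apply: eq_bigr => B sB.
  by rewrite monoP ?s_mono // (partition_neq0 sT sB).
(* One block that is not [mono] makes the whole [dot] product vanish. *)
case/forall_inPn=> B sB nmono; rewrite (bigD1 B) //=.
rewrite monoP ?(partition_neq0 sT sB) // (negPf nmono).
have dot0 z : dot 0 z = 0.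
  by have := pmul_linear dot (-1) 0 0 z; rewrite scaler0 addr0 scaleN1r addNr.
by rewrite dot0.
Qed.

End Trees.

(** * From blocks of leaves back to the indexed families *)

Theorem theorem1p6 (K : fieldType) (V : lmodType K)
    (dot star : comAlgProduct V)
    (n : nat) (k : 'I_n -> nat) (a : forall i : 'I_n, 'I_(k i) -> V)
    (nonempty : (0 < n)%N /\ (forall i, 0 < k i)%N \/ punit dot = punit star) :
  \big[dot/punit dot]_(i < n) \big[star/punit star]_(j < k i) a i j =
  \sum_(F : forest {i : 'I_n & 'I_(k i)} |
          reduced_forest F && mixing_forest (fun x => tag x) F)
     (-1) ^+ forest_weight F *:
       forest_cumulant dot star (fun x => a (tag x) (tagged x)) F.
Proof.
pose L : finType := {i : 'I_n & 'I_(k i)}%type; pose c (x : L) := tag x.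
have tag_ex i : (0 < k i)%N -> exists x : L, tag x = i.
  by case Dk: (k i) => [|m] // _; exists (existT _ i (cast_ord (esym Dk) ord0)).
have unitE : [set: L] = set0 -> punit dot = punit star.
  case: nonempty => // -[n0 k0] /setP L0.
  by have [x _] := tag_ex (Ordinal n0) (k0 _); have := L0 x; rewrite !inE.
rewrite forest_sum //.
pose fib i := [set y : L | tag y == i].
(* Only the nonempty fibers of [tag] are blocks; indices with an empty fiber are treated at the
   end. *)
have -> : preim_partition c setT = [set fib i | i in c @: [set: L]].
  rewrite -imset_comp; apply: eq_imset => x; apply/setP=> y.
  by rewrite !inE eq_sym.
rewrite big_imset /=; last first.
  move=> i j /imsetP[x _ ->] _ /setP/(_ x).
  by rewrite !inE eqxx => /esym/eqP.
rewrite [RHS]big_mkcond /=; apply: eq_bigr => i _.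
have fibE : \big[star/punit star]_(x in fib i) a (tag x) (tagged x) =
            \big[star/punit star]_(j < k i) a i j.
  rewrite -[RHS](big_pred1_eq star i
    (fun i => \big[star/punit star]_(j < k i) a i j)).
  by rewrite sig_big_dep; apply: eq_bigl => x; rewrite inE andbT.
case: imsetP => [_|tag_i]; first by rewrite fibE.
(* With no leaf over [i], the left factor is [punit star] and the right one [punit dot]. By
   [nonempty] either these agree, or [0 < k i] yields a leaf over [i]. *)
rewrite -fibE big_pred0 => [|x]; last first.
  by rewrite inE; apply/negP=> /eqP xi; case: tag_i; exists x.
case: nonempty => // -[_ /(_ i)/tag_ex[x xi]].
by case: tag_i; exists x.
Qed.
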